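(* For all integers $\alpha\geq 0$ and $n\geq 0$, $$ S\left(2^{5+2\alpha}n+\left(2^{5+2\alpha}-\frac{2^{2+2\alpha}-1}{3}\right)\right)\equiv 0 \pmod{16}. $$
   Context: For $|q|<1$ (or as formal power series in $q$), let $(a;q)_\infty:=\prod_{k\geq 0}(1-aq^k)$. The function $S(n)$ (the number of overpartitions of $n$ of Schur-type, in the sense of Broudy and Lovejoy) is defined by the generating function $$\sum_{n=0}^{\infty} S(n)q^n = \frac{1}{(q;q^6)_\infty(q^5;q^6)_\infty(q^6;q^6)_\infty}.$$ *)

(* Defs.v *)
From mathcomp Require Import all_boot all_order all_algebra.
From mathcomp Require Import zify.

Set Implicit Arguments.
Unset Strict Implicit.
Unset Printing Implicit Defensive.

Import GRing.Theory.
Local Open Scope ring_scope.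

(* A term f : fps stands for the formal power series \sum_n f n q^n. *)
Definition fps := nat -> int.

Definition fps_one : fps := fun n => (n == 0%N)%:R.

Definition fps_mul (f g : fps) : fps :=
  fun n => \sum_(i < n.+1) f i * g (n - i)%N.

(* First n coefficients of 1/f when f 0 = 1, from
   g_n = - \sum_(1 <= i <= n) f_i g_(n-i); when f 0 <> 1 the value is
   meaningless. *)
Fixpoint fps_inv_coefs (f : fps) (n : nat) : seq int :=
  if n is m.+1 then
    let s := fps_inv_coefs f m in
    rcons s (if m is 0%N then 1
             else - \sum_(i < m) f i.+1 * s`_(m - i.+1))
  else [::].

Definition fps_inv (f : fps) : fps := fun n => (fps_inv_coefs f n.+1)`_n.

(* (q^r; q^m)_oo for m > 0. The k-th factor 1 - q^(r + m k) is 1 modulo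
   q^(n+1) as soon as k > n, so the coefficient of q^n is already reached by
   the product of the first n + 1 factors (see qpochE). *)
Definition qpoch (r m : nat) : fps :=
  fun n => (\prod_(k < n.+1) (1 - 'X^(r + m * k)) : {poly int})`_n.

Definition schurS : fps :=
  fps_inv (fps_mul (fps_mul (qpoch 1 6) (qpoch 5 6)) (qpoch 6 6)).

Lemma qpochE (r m N n : nat) : (0 < m)%N -> (n < N)%N ->
  (\prod_(k < N) (1 - 'X^(r + m * k)) : {poly int})`_n = qpoch r m n.
Proof.
move=> m_gt0; elim: N => // N IHN; rewrite ltnS leq_eqVlt => /predU1P[->|ltnN].
  by [].
rewrite big_ord_recr /= mulrBr mulr1 coefB coefMXn IHN //.
have -> : (n < r + m * N)%N by nia.
by rewrite subr0.
Qed.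

Lemma size_fps_inv_coefs f n : size (fps_inv_coefs f n) = n.
Proof. by elim: n => //= n IHn; rewrite size_rcons IHn. Qed.

Lemma nth_fps_inv_coefs f n i : (i < n)%N -> (fps_inv_coefs f n)`_i = fps_inv f i.
Proof.
elim: n => // n IHn; rewrite ltnS leq_eqVlt => /predU1P[->|ltin] //.
by rewrite /= nth_rcons size_fps_inv_coefs ltin IHn.
Qed.

Lemma fps_mulfV (f : fps) : f 0%N = 1 -> fps_mul f (fps_inv f) =1 fps_one.
Proof.
move=> f0 [|n]; rewrite /fps_mul /fps_one; first by rewrite big_ord1 f0 mul1r.
rewrite big_ord_recl f0 mul1r subn0.
have -> : fps_inv f n.+1 = - \sum_(i < n.+1) f i.+1 * fps_inv f (n.+1 - i.+1)%N.
  rewrite {1}/fps_inv.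
  rewrite -[fps_inv_coefs f n.+2]/(rcons (fps_inv_coefs f n.+1)
    (- \sum_(i < n.+1) f i.+1 * (fps_inv_coefs f n.+1)`_(n.+1 - i.+1))).
  rewrite nth_rcons size_fps_inv_coefs ltnn eqxx; congr (- _).
  by apply: eq_bigr => i _; rewrite nth_fps_inv_coefs //; lia.
exact: addNr.
Qed.

Lemma qpoch0 r m : (0 < r)%N -> qpoch r m 0 = 1.
Proof.
case: r => // r _; rewrite /qpoch big_ord1 coefB coef1 coefXn.
by rewrite muln0 addn0 subr0.
Qed.

Lemma schurS_genfun :
  fps_mul (fps_mul (fps_mul (qpoch 1 6) (qpoch 5 6)) (qpoch 6 6)) schurS =1 fps_one.
Proof.
by apply: fps_mulfV; rewrite /fps_mul !big_ord1 /= !qpoch0.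
Qed.

Lemma dvd3_exp4_pred (a : nat) : (3 %| 2 ^ (2 + 2 * a) - 1)%N.
Proof.
elim: a => // a; have -> : (2 + 2 * a.+1 = (2 + 2 * a).+2)%N by lia.
rewrite !expnS; have : (0 < 2 ^ (2 + 2 * a))%N by rewrite expn_gt0.
by move: (2 ^ _)%N => x; lia.
Qed.

Lemma index_sub_le (a : nat) :
  ((2 ^ (2 + 2 * a) - 1) %/ 3 <= 2 ^ (5 + 2 * a))%N.
Proof.
rewrite (leq_trans (leq_div _ _)) // (leq_trans (leq_subr _ _)) //.
by rewrite leq_exp2l // leq_add2r.
Qed.

(* Main.v *)
Require Import Defs.
From HB Require Import structures.
From mathcomp Require Import all_boot all_order all_algebra.
From mathcomp Require Import zify ring boolp.

Set Implicit Arguments.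
Unset Strict Implicit.
Unset Printing Implicit Defensive.

Import GRing.Theory.
Local Open Scope ring_scope.

(** By the Jacobi triple product the generating function of S is 1 / Q(-q) with
    Q(q) = sum_k q^(3k^2+2k). Write P(q) = sum_k q^(3k^2+k) and let phi, psi be
    Ramanujan's theta functions. The dissection Q(q) = P(q^4) + q Q(q^4) and
    the product Q(q) phi(q^3) = P(q^2)^2 + q Q(q^2)^2, which comes from rotating
    the lattice Z^2, give
      Q(q) Q(-q) = Q(-q^2) phi(-q^6),    P^4 - q Q^4 = Q(-q) phi(-q^3)^3,
      T := sum_n S(4n+3) q^n = Q^3 / (Q(-q) phi(-q^3)^3).
    Since phi = 1 mod 2, phi(-q^3)^8 = 1 mod 16, so T can be bisected
    repeatedly modulo 16. Let U be the operator f(n) -> f(4n+2) on coefficients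
    and F = phi(q^3)^5 Q^2. Modulo 16,
      sum_n T(4n+3) q^n = 6 psi(q^6) P^2 + 8 P^3 Q^2,
      U T = 7 F + 8 q Q^5 + 8 q psi(q^6)^2 P^2,
      U F = F + 8 q psi(q^6)^2 P^2.
    The first series is even modulo 16, so T(8n+7) = 0 mod 16. For a > 0, U^a T
    is 7 F plus 8 times a series whose exponents congruent to 3 mod 4 have even
    coefficients, and F(8n+7) = 0 mod 16 as well. The index in the theorem is
    4 m + 3, where m is the image of 8n+7 under a iterations of k -> 4k+2. *)

(** * Formal power series *)

(** The wrapper is there to carry the ring structure; functional extensionality turns
    coefficientwise agreement into equality of terms. *)
Record ser := Ser { coefs :> nat -> int }.
HB.instance Definition _ := gen_eqMixin ser.
HB.instance Definition _ := gen_choiceMixin ser.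

Lemma serP (f g : ser) : f =1 g -> f = g.
Proof. by case: f g => [f] [g] /= /funext ->. Qed.

Definition ser_zero := Ser (fun=> 0).
Definition ser_add (f g : ser) := Ser (fun n => f n + g n).
Definition ser_opp (f : ser) := Ser (fun n => - f n).
Definition ser_mul (f g : ser) := Ser (fps_mul f g).

Lemma ser_addA : associative ser_add.
Proof. by move=> f g h; apply: serP => n /=; rewrite addrA. Qed.
Lemma ser_addC : commutative ser_add.
Proof. by move=> f g; apply: serP => n /=; rewrite addrC. Qed.
Lemma ser_add0 : left_id ser_zero ser_add.
Proof. by move=> f; apply: serP => n /=; rewrite add0r. Qed.
Lemma ser_addN : left_inverse ser_zero ser_opp ser_add.
Proof. by move=> f; apply: serP => n /=; rewrite addNr. Qed.
HB.instance Definition _ :=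
  GRing.isZmodule.Build ser ser_addA ser_addC ser_add0 ser_addN.

(** A coefficient of a product depends only on truncations of the factors, so ring laws transfer
    from [{poly int}]. *)
Definition trunc (N : nat) (f : ser) : {poly int} := \poly_(i < N) f i.

Lemma coef_trunc N f i : (i < N)%N -> (trunc N f)`_i = f i.
Proof. by move=> ltiN; rewrite coef_poly ltiN. Qed.

Lemma trunc_mul N f g n : (n < N)%N ->
  (trunc N f * trunc N g)`_n = ser_mul f g n.
Proof.
move=> ltnN; rewrite coefM; apply: eq_bigr => i _.
by rewrite !coef_trunc //; have := ltn_ord i; lia.
Qed.

Lemma ser_mulA : associative ser_mul.
Proof.
move=> f g h; apply: serP => n; pose t := trunc n.+1.
transitivity ((t f * (t g * t h))`_n).
  rewrite coefM; apply: eq_bigr => i _; have lti := ltn_ord i.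
  by rewrite coef_trunc // trunc_mul //; lia.
rewrite mulrA coefM; apply: eq_bigr => i _; have lti := ltn_ord i.
by rewrite trunc_mul // coef_trunc //; lia.
Qed.

Lemma ser_mulC : commutative ser_mul.
Proof.
by move=> f g; apply: serP => n; rewrite -!(@trunc_mul n.+1) // mulrC.
Qed.

Lemma ser_mul1 : left_id (Ser fps_one) ser_mul.
Proof.
move=> f; apply: serP => n; rewrite /= /fps_mul big_ord_recl subn0.
rewrite /fps_one mul1r big1 ?addr0 // => i _.
by rewrite mul0r.
Qed.

Lemma ser_mulDl : left_distributive ser_mul ser_add.
Proof.
move=> f g h; apply: serP => n /=; rewrite /fps_mul -big_split /=.
by apply: eq_bigr => i _; rewrite mulrDl.
Qed.

Lemma ser_one_neq0 : Ser fps_one != 0.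
Proof. by apply/eqP => /(congr1 (fun f : ser => f 0%N)). Qed.

HB.instance Definition _ := GRing.Zmodule_isComNzRing.Build ser
  ser_mulA ser_mulC ser_mul1 ser_mulDl ser_one_neq0.

Lemma serDE (f g : ser) n : (f + g) n = f n + g n. Proof. by []. Qed.
Lemma serNE (f : ser) n : (- f) n = - f n. Proof. by []. Qed.
Lemma ser0E n : (0 : ser) n = 0. Proof. by []. Qed.
Lemma ser1E n : (1 : ser) n = (n == 0%N)%:R. Proof. by []. Qed.
Lemma serME (f g : ser) n : (f * g) n = \sum_(i < n.+1) f i * g (n - i)%N.
Proof. by []. Qed.

Lemma ser_natmulE (f : ser) m n : (m%:R * f) n = m%:R * f n.
Proof.
elim: m => [|m IHm]; first by rewrite !mul0r.
by rewrite !mulrS !mulrDl !mul1r serDE IHm.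
Qed.

Lemma ser_sumE I r (P : pred I) (F : I -> ser) n :
  (\sum_(i <- r | P i) F i) n = \sum_(i <- r | P i) F i n.
Proof. exact: (big_morph (fun f : ser => f n) (fun f g => serDE f g n) (ser0E n)). Qed.

Definition Xs : ser := Ser (fun n => (n == 1%N)%:R).

Lemma serXE (f : ser) n : (Xs * f) n = if n is m.+1 then f m else 0.
Proof.
rewrite serME; case: n => [|n]; first by rewrite big_ord1 mul0r.
rewrite big_ord_recl mul0r add0r big_ord_recl /= mul1r.
rewrite big1 ?addr0 => [|i _]; first by rewrite subSS subn0.
by rewrite mul0r.
Qed.

Lemma serXnE (f : ser) m n :
  (Xs ^+ m * f) n = if (m <= n)%N then f (n - m)%N else 0.
Proof.
elim: m n => [|m IHm] n; first by rewrite expr0 mul1r subn0.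
by rewrite exprS -mulrA serXE; case: n => // n; rewrite IHm ltnS subSS.
Qed.

(* [dil m f] is f(q^m); meaningful for m > 0 only. *)
Definition dil (m : nat) (f : ser) : ser :=
  Ser (fun n => if (m %| n)%N then f (n %/ m)%N else 0).

Lemma dilE m f n : dil m f n = if (m %| n)%N then f (n %/ m)%N else 0.
Proof. by []. Qed.

Lemma coef_dil_trunc m f N n : (0 < m)%N -> (n < N)%N ->
  (trunc N f \Po 'X^m)`_n = dil m f n.
Proof.
move=> m_gt0 ltnN; rewrite coef_comp_poly_Xn // dilE; case: ifP => // _.
by rewrite coef_trunc // (leq_ltn_trans (leq_div _ _)).
Qed.

Lemma dilM m f g : (0 < m)%N -> dil m (f * g) = dil m f * dil m g.
Proof.
move=> m_gt0; apply: serP => n; pose t := trunc n.+1.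
transitivity (((t f \Po 'X^m) * (t g \Po 'X^m))`_n); last first.
  rewrite coefM; apply: eq_bigr => i _; have lti := ltn_ord i.
  by rewrite !coef_dil_trunc //; lia.
rewrite -comp_polyM coef_comp_poly_Xn // dilE; case: ifP => // _.
by rewrite trunc_mul // ltnS leq_div.
Qed.

Lemma dil_is_zmod m : zmod_morphism (dil m).
Proof.
move=> f g; apply: serP => n; rewrite serDE serNE !dilE.
by case: ifP => // _; rewrite subrr.
Qed.

Lemma dil_is_monoid m : monoid_morphism (dil m.+1).
Proof.
split=> [|f g]; last exact: dilM.
apply: serP => -[|n]; rewrite dilE ?dvdn0 ?div0n // !ser1E.
by case: ifP => // /divnK; case: divn.
Qed.

HB.instance Definition _ m := GRing.isZmodMorphism.Build ser ser (dil m)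
  (dil_is_zmod m).
HB.instance Definition _ m := GRing.isMonoidMorphism.Build ser ser (dil m.+1)
  (dil_is_monoid m).

Lemma dilX m : (0 < m)%N -> dil m Xs = Xs ^+ m.
Proof.
move=> m_gt0; apply: serP => n; rewrite -[Xs ^+ _]mulr1 serXnE dilE ser1E.
have -> : (if (m <= n)%N then ((n - m)%N == 0%N)%:R else 0) = (n == m)%:R :> int.
  by rewrite subn_eq0 eqn_leq andbC; case: leqP.
case: ifP => [/dvdnP[k ->]|]; last by case: eqP => // ->; rewrite dvdnn.
by rewrite mulnK //= -{2}[m]mul1n eqn_pmul2r.
Qed.

Lemma dil_dil m k f : (0 < m)%N -> (0 < k)%N -> dil m (dil k f) = dil (k * m) f.
Proof.
move=> m0 k0; apply: serP => n; rewrite !dilE.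
case: (boolP (k * m %| n)%N) => [/dvdnP[j ->]|].
  by rewrite !mulnA dvdn_mull // !mulnK ?dvdn_mull // -mulnA mulnK ?muln_gt0 ?k0.
case: ifP => // /dvdnP[j ->] nd; rewrite mulnK //; case: ifP => // /dvdnP[i ji].
by case/negP: nd; rewrite ji -mulnA dvdn_mull.
Qed.

Lemma dil_comm m k f : (0 < m)%N -> (0 < k)%N -> dil m (dil k f) = dil k (dil m f).
Proof. by move=> m0 k0; rewrite !dil_dil // mulnC. Qed.

(* [alt f] is f(-q). *)
Definition alt (f : ser) : ser := Ser (fun n => (-1) ^+ n * f n).

Lemma alt_is_zmod : zmod_morphism alt.
Proof. by move=> f g; apply: serP => n; rewrite serDE serNE /= mulrBr. Qed.

Lemma alt_is_monoid : monoid_morphism alt.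
Proof.
split=> [|f g]; apply: serP => n.
  by rewrite /= /fps_one; case: n => // n; rewrite mulr0.
rewrite serME [LHS]/= /fps_mul mulr_sumr; apply: eq_bigr => i _ /=.
have -> : (-1) ^+ n = (-1) ^+ i * (-1) ^+ (n - i) :> int.
  by rewrite -exprD subnKC // -ltnS.
by ring.
Qed.

HB.instance Definition _ := GRing.isZmodMorphism.Build ser ser alt alt_is_zmod.
HB.instance Definition _ := GRing.isMonoidMorphism.Build ser ser alt alt_is_monoid.

Lemma altX : alt Xs = - Xs.
Proof. by apply: serP => n; rewrite serNE /=; case: n => [|[|n]] //=; rewrite ?mulr0 ?oppr0. Qed.

Lemma alt_dil m f : ~~ odd m -> alt (dil m f) = dil m f.
Proof.
move=> evm; apply: serP => n; rewrite /=; case: ifP => [/dvdnP[k ->]|].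
  by rewrite -signr_odd oddM (negPf evm) andbF mul1r.
by rewrite mulr0.
Qed.

Definition sec (m r : nat) (f : ser) : ser := Ser (fun n => f (m * n + r)%N).

Local Notation E2 := (dil 2).

Lemma ser_bisect f : f = E2 (sec 2 0 f) + Xs * E2 (sec 2 1 f).
Proof.
apply: serP => n; rewrite serDE serXE dilE /= addn0.
have [|] := boolP (2 %| n)%N => dvn.
  rewrite mulnC divnK //; case: n dvn => [|n] dvn; first by rewrite addr0.
  by rewrite ifN ?addr0 //; lia.
case: n dvn => // n dvn; rewrite ifT ?add0r; last by lia.
by congr (f _); lia.
Qed.

Lemma secE m r f n : sec m r f n = f (m * n + r)%N. Proof. by []. Qed.

Lemma sec20_bisect u v : sec 2 0 (E2 u + Xs * E2 v) = u.
Proof.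
apply: serP => n; rewrite secE addn0 serDE serXE dilE dvdn_mulr // mulKn //.
case: n => [|n]; first by rewrite addr0.
by rewrite mulnS addSn dilE ifN ?addr0 //; lia.
Qed.

Lemma sec21_bisect u v : sec 2 1 (E2 u + Xs * E2 v) = v.
Proof.
apply: serP => n; rewrite secE addn1 serDE serXE !dilE dvdn_mulr // mulKn //.
by rewrite ifN ?add0r //; lia.
Qed.

Lemma sec20E u : sec 2 0 (E2 u) = u.
Proof. by rewrite -[RHS](sec20_bisect _ 0) rmorph0 mulr0 addr0. Qed.

Lemma sec21E u : sec 2 1 (E2 u) = 0.
Proof. by rewrite -[RHS](sec21_bisect u 0) rmorph0 mulr0 addr0. Qed.

Lemma secD m r f g : sec m r (f + g) = sec m r f + sec m r g.
Proof. by []. Qed.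

Lemma secMn m r k f : sec m r (k%:R * f) = k%:R * sec m r f.
Proof. by apply: serP => n; rewrite secE !ser_natmulE. Qed.

Lemma sec_bisectM f g :
  f * g = E2 (sec 2 0 f * sec 2 0 g + Xs * sec 2 1 f * sec 2 1 g)
        + Xs * E2 (sec 2 0 f * sec 2 1 g + sec 2 1 f * sec 2 0 g).
Proof.
rewrite {1}[f]ser_bisect {1}[g]ser_bisect !(rmorphD, rmorphM) /= dilX //.
by ring.
Qed.

Lemma sec21M f g :
  sec 2 1 (f * g) = sec 2 0 f * sec 2 1 g + sec 2 1 f * sec 2 0 g.
Proof. by rewrite sec_bisectM sec21_bisect. Qed.

Lemma E2_inj : injective E2.
Proof. by move=> f g /(congr1 (sec 2 0)); rewrite !sec20E. Qed.

(** * Theta series and their dissections *)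

(* [f] is the sum of the monomials q^(e i) over all i : I, the fibres of e
   being finite and listed by s. *)
Definition gensum (I : eqType) (e : I -> nat) (f : ser) :=
  exists s : nat -> seq I, forall n,
    [/\ uniq (s n), forall i, (i \in s n) = (e i == n) & f n = (size (s n))%:R].

(** Both coefficients count the same fibre of [e]. Theta identities thus reduce to
    exponent-preserving bijections of index sets, supplied through [gensum_can]. *)
Lemma gensum_unique (I : eqType) (e : I -> nat) f g :
  gensum e f -> gensum e g -> f = g.
Proof.
case=> s sP [t tP]; apply: serP => n.
have [us ms ->] := sP n; have [ut mt ->] := tP n.
by rewrite (perm_size (uniq_perm us ut _)) // => i; rewrite ms mt.
Qed.

Lemma gensum_can (I J : eqType) (e : I -> nat) (e' : J -> nat)
    (h : J -> I) (g : I -> J) f :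
  cancel g h -> cancel h g -> (forall j, e' j = e (h j)) ->
  gensum e f -> gensum e' f.
Proof.
move=> gK hK e'E [s sP]; exists (fun n => map g (s n)) => n.
have [us ms ->] := sP n; split=> [|j|]; last by rewrite size_map.
  by rewrite map_inj_uniq //; apply: can_inj gK.
by rewrite -{1}[j]hK mem_map ?ms ?e'E //; apply: can_inj gK.
Qed.

Lemma gensum_add (I J : eqType) (e : I -> nat) (e' : J -> nat) f g :
  gensum e f -> gensum e' g ->
  gensum (fun x : I + J => match x with inl i => e i | inr j => e' j end) (f + g).
Proof.
case=> s sP [t tP]; exists (fun n => map inl (s n) ++ map inr (t n)) => n.
have [us ms fE] := sP n; have [ut mt gE] := tP n.
have injl : injective (@inl I J) by move=> ? ? [].
have injr : injective (@inr I J) by move=> ? ? [].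
split; last by rewrite size_cat !size_map natrD serDE fE gE.
  rewrite cat_uniq !map_inj_uniq // us ut /= andbT.
  by apply/hasPn => _ /mapP[j _ ->]; apply/mapP => -[].
case=> [i|j]; rewrite mem_cat.
  rewrite mem_map // ms; case: mapP => [[]//|_]; exact: orbF.
by rewrite [X in _ || X]mem_map // mt; case: mapP => [[]//|_].
Qed.

Lemma gensum_mul (I J : eqType) (e : I -> nat) (e' : J -> nat) f g :
  gensum e f -> gensum e' g ->
  gensum (fun x : I * J => e x.1 + e' x.2)%N (f * g).
Proof.
case=> s sP [t tP].
exists (fun n => [seq x | k <- iota 0 n.+1,
                     x <- [seq (i, j) | i <- s k, j <- t (n - k)%N]]) => n.
have mem_st k m x : (x \in [seq (i, j) | i <- s k, j <- t m])
    = (e x.1 == k) && (e' x.2 == m).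
  have [_ ms _] := sP k; have [_ mt _] := tP m.
  case: x => i j; rewrite -ms -mt.
  by apply/allpairsP/andP => [[[a b] /= [? ? [-> ->]]]//|[? ?]]; exists (i, j).
split.
- apply: allpairs_uniq_dep; first exact: iota_uniq.
    move=> k _; have [us _ _] := sP k; have [ut _ _] := tP (n - k)%N.
    by apply: allpairs_uniq => // -[? ?] [].
  move=> x y /allpairsPdep[k [u [_ + ->]]] /allpairsPdep[l [v [_ + ->]]] /=.
  by rewrite !mem_st => /andP[/eqP <- _] /andP[/eqP <- _] ->.
- move=> x; apply/allpairsPdep/eqP => [[k [y [+ + ->]]]|exn].
    by rewrite mem_st mem_iota => ? /andP[/eqP ? /eqP ?]; lia.
  exists (e x.1), x; rewrite mem_st mem_iota; split=> //; first by lia.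
  by apply/andP; split; apply/eqP; lia.
rewrite serME size_allpairs_dep sumnE big_map natr_sum -[iota _ _]/(index_iota 0 n.+1) big_mkord.
apply: eq_bigr => k _; rewrite size_allpairs natrM.
by have [_ _ ->] := sP k; have [_ _ ->] := tP (n - k)%N.
Qed.

Lemma gensum_Xn (I : eqType) (e : I -> nat) m f :
  gensum e f -> gensum (fun i => m + e i)%N (Xs ^+ m * f).
Proof.
case=> s sP; exists (fun n => if (m <= n)%N then s (n - m)%N else [::]) => n.
rewrite serXnE; case: leqP => lemn; last first.
  by split=> // i; rewrite in_nil; apply/esym/eqP; lia.
have [us ms ->] := sP (n - m)%N; split=> // i.
by rewrite ms; apply/eqP/eqP; lia.
Qed.

Lemma gensum_dil (I : eqType) (e : I -> nat) m f : (0 < m)%N ->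
  gensum e f -> gensum (fun i => m * e i)%N (dil m f).
Proof.
move=> m_gt0 [s sP].
exists (fun n => if (m %| n)%N then s (n %/ m)%N else [::]) => n.
rewrite dilE; case: ifP => dvn; last first.
  by split=> // i; rewrite in_nil; apply/esym/eqP => ni; rewrite -ni dvdn_mulr in dvn.
have [us ms ->] := sP (n %/ m)%N; split=> // i.
by rewrite ms -{2}(divnK dvn) mulnC eqn_pmul2r.
Qed.

Lemma gensum_even (I : eqType) (e : I -> nat) f :
  (forall i, ~~ odd (e i)) -> gensum e f -> f = E2 (sec 2 0 f).
Proof.
move=> eve [s sP]; rewrite {1}[f]ser_bisect; set g := sec 2 1 f.
suff -> : g = 0 by rewrite rmorph0 mulr0 addr0.
apply: serP => n; rewrite secE; have [_ ms ->] := sP (2 * n + 1)%N.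
case: (s _) ms => // i r /(_ i); rewrite mem_head => /esym/eqP ei.
by have := eve i; rewrite ei addn1 /= oddM.
Qed.

Definition zrange (n : nat) : seq int := [seq i%:Z - n%:Z | i <- iota 0 n.*2.+1].

Lemma zrange_uniq n : uniq (zrange n).
Proof. by rewrite map_inj_uniq ?iota_uniq // => i j; lia. Qed.

Lemma mem_zrange n (k : int) : (k \in zrange n) = (`|k| <= n)%N.
Proof.
apply/mapP/idP => [[i]|kn]; first by rewrite mem_iota => ? ->; lia.
by exists (absz (k + n%:Z)); rewrite ?mem_iota; lia.
Qed.

(** The absolute value only serves to land in [nat]: for b <= a the integer a k^2 + b k is never
    negative. *)
Definition qexp (a b : nat) (k : int) : nat := absz (a%:Z * k ^+ 2 + b%:Z * k).

Lemma qexpE a b k : (b <= a)%N -> (qexp a b k)%:Z = a%:Z * k ^+ 2 + b%:Z * k.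
Proof.
move=> leba; rewrite /qexp gez0_abs // expr2; case: k => m; first by lia.
have := leq_mul leba (leqnn m.+1); have := leq_mul (leqnn (a * m.+1)%N) (ltn0Sn m).
by rewrite NegzE muln1; lia.
Qed.

(** The slack of one is attained at k = -1 with a = b, where the exponent is 0. *)
Lemma absz_le_qexp a b k : (0 < a)%N -> (b <= a)%N -> (`|k| <= (qexp a b k).+1)%N.
Proof.
move=> a0 leba; have := qexpE k leba; rewrite expr2; move: (qexp _ _ _) => n.
case: k => m; first by nia.
have := leq_mul leba (leqnn m.+1); have := leq_mul a0 (leqnn (m.+1 * m)%N).
by rewrite NegzE mul1n; case: m => [|m]; nia.
Qed.

(* [theta a b] is the sum of q^(a k^2 + b k) over all integers k; the summands
   contributing to q^n have |k| <= n + 1. *)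
Definition theta (a b : nat) : ser :=
  Ser (fun n => (size [seq k <- zrange n.+1 | qexp a b k == n])%:R).

Lemma theta_gensum a b : (0 < a)%N -> (b <= a)%N -> gensum (qexp a b) (theta a b).
Proof.
move=> a0 leba; exists (fun n => [seq k <- zrange n.+1 | qexp a b k == n]) => n.
split=> // [|k]; first by rewrite filter_uniq ?zrange_uniq.
rewrite mem_filter mem_zrange; case: eqP => // <-.
by rewrite absz_le_qexp.
Qed.

(** This is psi(q^2) in Ramanujan's notation. *)
Definition halftheta : ser :=
  Ser (fun n => (size [seq k <- iota 0 n.+1 | (k * k + k)%N == n])%:R).

Lemma halftheta_gensum : gensum (fun k : nat => k * k + k)%N halftheta.
Proof.
exists (fun n => [seq k <- iota 0 n.+1 | (k * k + k)%N == n]) => n.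
split=> // [|k]; first by rewrite filter_uniq ?iota_uniq.
by rewrite mem_filter mem_iota; case: eqP => // <-; nia.
Qed.

(** The reflection k -> -1 - k preserves k^2 + k and exchanges the nonnegative and negative
    integers, the two constructors of [int]. *)
Lemma theta11E : theta 1 1 = 2 * halftheta.
Proof.
have -> : 2 * halftheta = halftheta + halftheta by ring.
apply: gensum_unique (theta_gensum _ _) _ => //.
pose g (k : int) : nat + nat := match k with Posz m => inl m | Negz m => inr m end.
pose h (x : nat + nat) : int := match x with inl m => Posz m | inr m => Negz m end.
apply: (gensum_can (h := g) (g := h)) (gensum_add halftheta_gensum halftheta_gensum).
- by case.
- by case.
by move=> k; apply/eqP; rewrite -eqz_nat qexpE // expr2; apply/eqP; case: k => m /=; lia.
Qed.

Definition zhalves (k : int) : int + int :=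
  if (2 %| k)%Z then inl (k %/ 2)%Z else inr (k %/ 2)%Z.
Definition zunhalves (x : int + int) : int :=
  match x with inl k => 2 * k | inr k => 2 * k + 1 end.

Lemma zhalvesK : cancel zhalves zunhalves.
Proof. by move=> k; rewrite /zhalves; case: ifP => /=; lia. Qed.
Lemma zunhalvesK : cancel zunhalves zhalves.
Proof. by case=> k; rewrite /zhalves /=; case: ifP => ?; try congr (_ _); lia. Qed.

Definition zneg (x : int + int) : int + int :=
  match x with inl k => inl k | inr k => inr (- k - 1) end.
Lemma znegK : involutive zneg.
Proof. by case=> k //=; congr (inr _); lia. Qed.

(** An even index 2u contributes the exponent 4(3u^2 + u). An odd index, written -2u - 1 by means of
    [zneg], contributes 4(3u^2 + 2u) + 1. *)
Lemma theta32_quadrisect : theta 3 2 = dil 4 (theta 3 1) + Xs * dil 4 (theta 3 2).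
Proof.
apply: gensum_unique (theta_gensum _ _) _ => //.
rewrite -[X in X * _]expr1.
apply: (gensum_can (h := zneg \o zhalves) (g := zunhalves \o zneg))
  (gensum_add (gensum_dil _ (theta_gensum _ _))
     (gensum_Xn 1 (gensum_dil _ (theta_gensum _ _)))) => //.
- by move=> x; rewrite /= zunhalvesK znegK.
- by move=> x; rewrite /= znegK zhalvesK.
move=> k; rewrite -{1}[k]zhalvesK /=; case: (zhalves k) => u /=;
  by apply/eqP; rewrite -eqz_nat ?PoszD ?PoszM !qexpE //; apply/eqP; ring.
Qed.

Lemma theta10_quadrisect : theta 1 0 = dil 4 (theta 1 0) + Xs * dil 4 (theta 1 1).
Proof.
apply: gensum_unique (theta_gensum _ _) _ => //.
rewrite -[X in X * _]expr1.
apply: (gensum_can (h := zhalves) (g := zunhalves))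
  (gensum_add (gensum_dil _ (theta_gensum _ _))
     (gensum_Xn 1 (gensum_dil _ (theta_gensum _ _)))) => //.
- exact: zunhalvesK.
- exact: zhalvesK.
move=> k; rewrite -{1}[k]zhalvesK /=; case: (zhalves k) => u /=;
  by apply/eqP; rewrite -eqz_nat ?PoszD ?PoszM !qexpE //; apply/eqP; ring.
Qed.

(** The substitution j = u + v, k = u - v reaches exactly the pairs of equal parity; for the others
    j is shifted by one. The two summands are these two cosets. *)
Definition rotate (x : int * int) : int * int + int * int :=
  if (2 %| x.1 - x.2)%Z then inl ((x.1 + x.2) %/ 2, (x.1 - x.2) %/ 2)%Z
  else inr ((x.1 + x.2) %/ 2, (x.1 - x.2) %/ 2)%Z.
Definition unrotate (x : int * int + int * int) : int * int :=
  match x with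
  | inl (u, v) => (u + v, u - v)
  | inr (u, v) => (u + v + 1, u - v)
  end.

Lemma rotateK : cancel rotate unrotate.
Proof.
by case=> j k; rewrite /rotate /=; case: ifP => /= ?; congr (_, _); lia.
Qed.

Lemma unrotateK : cancel unrotate rotate.
Proof.
case=> [] [u v]; rewrite /rotate /=; case: ifP => /= ?; try lia.
  by congr (inl (_, _)); lia.
by congr (inr (_, _)); lia.
Qed.

Definition rneg (x : int * int + int * int) : int * int + int * int :=
  match x with inl x => inl x | inr (u, v) => inr (- u - 1, - v - 1) end.
Lemma rnegK : involutive rneg.
Proof. by case=> [[u v]|[u v]] //=; congr (inr (_, _)); lia. Qed.

Lemma theta10_sqr :
  theta 1 0 ^+ 2 = E2 (theta 1 0) ^+ 2 + Xs * E2 (theta 1 1) ^+ 2.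
Proof.
rewrite !expr2 -[X in X * (_ * _)]expr1.
have t10 := @theta_gensum 1 0 isT isT; have t11 := @theta_gensum 1 1 isT isT.
apply: gensum_unique (gensum_mul t10 t10) _.
have d10 := gensum_dil (isT : (0 < 2)%N) t10.
have d11 := gensum_dil (isT : (0 < 2)%N) t11.
apply: (gensum_can (h := rotate) (g := unrotate))
  (gensum_add (gensum_mul d10 d10) (gensum_Xn 1 (gensum_mul d11 d11))).
- exact: unrotateK.
- exact: rotateK.
move=> x; rewrite -{1 2}[x]rotateK; case: (rotate x) => -[u v] /=;
  by apply/eqP; rewrite -eqz_nat ?(PoszD, PoszM) !qexpE //; apply/eqP; ring.
Qed.

(** Under the rotation, 3j^2 + 2j + 3k^2 becomes 2(3u^2 + u) + 2(3v^2 + v) on pairs of equal parity.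
    On the other coset it becomes 2(3u^2 + 2u) + 2(3v^2 + 2v) + 1, once [rneg] has reflected both
    coordinates. *)
Lemma theta32_mul :
  theta 3 2 * dil 3 (theta 1 0)
  = E2 (theta 3 1) ^+ 2 + Xs * E2 (theta 3 2) ^+ 2.
Proof.
rewrite !expr2 -[X in X * (_ * _)]expr1.
have t10 := gensum_dil (isT : (0 < 3)%N) (@theta_gensum 1 0 isT isT).
have t32 := @theta_gensum 3 2 isT isT.
apply: gensum_unique (gensum_mul t32 t10) _.
have d31 := gensum_dil (isT : (0 < 2)%N) (@theta_gensum 3 1 isT isT).
have d32 := gensum_dil (isT : (0 < 2)%N) t32.
apply: (gensum_can (h := rneg \o rotate) (g := unrotate \o rneg))
  (gensum_add (gensum_mul d31 d31) (gensum_Xn 1 (gensum_mul d32 d32))).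
- by move=> x; rewrite /= unrotateK rnegK.
- by move=> x; rewrite /= rnegK rotateK.
move=> x; rewrite -{1 2}[x]rotateK /=; case: (rotate x) => -[u v] /=;
  by apply/eqP; rewrite -eqz_nat ?(PoszD, PoszM) !qexpE //; apply/eqP; ring.
Qed.

Lemma theta31_even : theta 3 1 = E2 (sec 2 0 (theta 3 1)).
Proof.
apply: gensum_even (theta_gensum _ _) => // k.
rewrite -[k]zhalvesK; case: (zhalves k) => u.
  by have := @qexpE 3 1 (zunhalves (inl u)) isT; rewrite expr2 /=; lia.
by have := @qexpE 3 1 (zunhalves (inr u)) isT; rewrite expr2 /=; lia.
Qed.

Lemma halftheta_even : halftheta = E2 (sec 2 0 halftheta).
Proof.
by apply: gensum_even halftheta_gensum => k; rewrite oddD oddM andbb addbb.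
Qed.

(** * Triple product *)

(** Gaussian binomial coefficients, given by the q-Pascal rule so that no division occurs. *)
Fixpoint gauss (R : comNzRingType) (q : R) (n k : nat) : R :=
  match n, k with
  | _, 0%N => 1
  | 0%N, _.+1 => 0
  | n'.+1, k'.+1 => gauss q n' k' + q ^+ k * gauss q n' k
  end.

Section Gauss.
Variables (R : comNzRingType) (q : R).

Lemma gauss_n0 n : gauss q n 0 = 1. Proof. by case: n. Qed.

Lemma gaussSS n k :
  gauss q n.+1 k.+1 = gauss q n k + q ^+ k.+1 * gauss q n k.+1.
Proof. by []. Qed.

Lemma gauss_small n k : (n < k)%N -> gauss q n k = 0.
Proof.
by elim: n k => [|n IHn] [|k] //= ltnk; rewrite !IHn ?mulr0 ?addr0 //; lia.
Qed.

Lemma gauss_nn n : gauss q n n = 1.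
Proof. by elim: n => //= n ->; rewrite gauss_small // mulr0 addr0. Qed.

(** Induction on n: split off the factor y + z and apply the hypothesis to z q; the q-Pascal rule
    recombines the two sums. *)
Lemma gauss_binomial n (y z : R) :
  \prod_(i < n) (y + z * q ^+ i)
  = \sum_(k < n.+1) q ^+ 'C(k, 2) * z ^+ k * y ^+ (n - k) * gauss q n k.
Proof.
elim: n z => [|n IHn] z; first by rewrite big_ord0 big_ord1 !expr0 !mulr1.
rewrite big_ord_recl expr0 mulr1.
under eq_bigr do rewrite exprS mulrA.
rewrite IHn [RHS]big_ord_recl gauss_n0 subn0 !expr0 !mul1r mulr1.
under [in RHS]eq_bigr => k _ do
  rewrite /= mulrDr subSS binS bin1 exprD [z ^+ k.+1]exprS.
rewrite big_split /= mulrDl [LHS]addrC [RHS]addrCA; congr (_ + _).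
  rewrite mulr_sumr; apply: eq_bigr => k _; rewrite exprMn; ring.
rewrite [in RHS]big_ord_recr /= gauss_small // mulr0 mulr0 addr0.
rewrite [in LHS]big_ord_recl gauss_n0 subn0 !expr0 !mul1r mulr1 mulrDr -exprS.
congr (_ + _); rewrite mulr_sumr; apply: eq_bigr => k _.
rewrite /= /bump /= add1n binS bin1 exprD exprMn !exprS.
have -> : (n - k = (n - k.+1).+1)%N by have := ltn_ord k; lia.
by rewrite exprS; ring.
Qed.

Definition poch n := \prod_(i < n) (1 - q ^+ i.+1).

Lemma pochS n : poch n.+1 = poch n * (1 - q ^+ n.+1).
Proof. by rewrite /poch big_ord_recr. Qed.

Lemma gauss_poch a b : gauss q (a + b) a * poch a * poch b = poch (a + b).
Proof.
elim: a b => [|a IHa] b; first by rewrite gauss_n0 /poch big_ord0 !mul1r.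
elim: b => [|b IHb].
  by rewrite addn0 gauss_nn /poch big_ord0 mul1r mulr1.
have := IHa b.+1; rewrite addnS -addSn => IHa'.
rewrite [(a.+1 + b.+1)%N]addnS gaussSS.
transitivity (gauss q (a.+1 + b) a * poch a * poch b.+1 * (1 - q ^+ a.+1)
  + q ^+ a.+1 * (gauss q (a.+1 + b) a.+1 * poch a.+1 * poch b) * (1 - q ^+ b.+1)).
  by rewrite !pochS; ring.
by rewrite IHa' IHb pochS -addnS exprD; ring.
Qed.
End Gauss.

Lemma XsnI m : injective (fun f : ser => Xs ^+ m * f).
Proof.
move=> f g /= fg; apply: serP => n; have := congr1 (fun h : ser => h (n + m)%N) fg.
by rewrite !serXnE leq_addl addnK.
Qed.

(* The q-binomial theorem with base q^6, y = q^(6n) and z = -q^5, cleared of a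
   power of q. *)
Lemma finite_triple_product n :
  (\prod_(i < n) (1 - Xs ^+ (1 + 6 * i))) * (\prod_(i < n) (1 - Xs ^+ (5 + 6 * i)))
  = \sum_(k <- iota 0 n.*2.+1) (-1) ^+ qexp 3 2 (k%:Z - n%:Z)
      * Xs ^+ qexp 3 2 (k%:Z - n%:Z) * gauss (Xs ^+ 6) n.*2 k.
Proof.
(* [M] is the total power of q released by the 2n factors; the first n of them also release the sign
   (-1)^n. *)
pose M := (5 * n + 6 * 'C(n, 2) + 6 * n * n)%N.
apply: (@XsnI M); apply: (can_inj (signrMK n)).
have := @gauss_binomial _ (Xs ^+ 6) (n + n) (Xs ^+ (6 * n)) (- Xs ^+ 5).
rewrite big_split_ord [X in X * _ = _ -> _]/= [X in _ * X = _ -> _]/=.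
have -> : \prod_(i < n) (Xs ^+ (6 * n) + - Xs ^+ 5 * Xs ^+ 6 ^+ i)
    = (-1) ^+ n * Xs ^+ (5 * n + 6 * 'C(n, 2)) * \prod_(i < n) (1 - Xs ^+ (1 + 6 * i)).
  (* Factor i on the left is q^(6n) - q^(5+6i) = -q^(5+6i) (1 - q^(1+6(n-1-i))), hence the reversal
     of the index. *)
  rewrite [X in _ = _ * X](reindex_inj rev_ord_inj) /=.
  have -> : (-1) ^+ n * Xs ^+ (5 * n + 6 * 'C(n, 2))
      = \prod_(i < n) (- Xs ^+ (5 + 6 * i)) :> ser.
    rewrite prodrN card_ord -expr_sum; congr (_ * Xs ^+ _).
    rewrite big_split /= sum_nat_const card_ord -big_distrr /= mulnC; congr (_ + 6 * _)%N.
    by rewrite -bin2_sum big_mkord.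
  rewrite -big_split; apply: eq_bigr => i _ /=; have lti := ltn_ord i.
  have : (6 * n = (5 + 6 * i) + (1 + 6 * (n - i.+1)))%N by lia.
  rewrite -exprM; move: (6 * i)%N (6 * (n - i.+1))%N => u v ->.
  by rewrite !exprD; ring.
have -> : \prod_(i < n) (Xs ^+ (6 * n) + - Xs ^+ 5 * Xs ^+ 6 ^+ (n + i))
    = Xs ^+ (6 * n * n) * \prod_(i < n) (1 - Xs ^+ (5 + 6 * i)).
  have -> : Xs ^+ (6 * n * n) = \prod_(i < n) Xs ^+ (6 * n).
    by rewrite -expr_sum sum_nat_const card_ord mulnC.
  rewrite -big_split; apply: eq_bigr => i _ /=.
  rewrite -exprM mulnDr; move: (6 * i)%N (6 * n)%N => u v.
  by rewrite !exprD; ring.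
move=> eq12; transitivity ((-1) ^+ n * Xs ^+ (5 * n + 6 * 'C(n, 2))
  * (\prod_(i < n) (1 - Xs ^+ (1 + 6 * i)))
  * (Xs ^+ (6 * n * n) * (\prod_(i < n) (1 - Xs ^+ (5 + 6 * i))))).
  by rewrite /M [Xs ^+ (_ + 6 * n * n)]exprD; ring.
rewrite {}eq12 addnn -(big_mkord xpredT (fun k => Xs ^+ 6 ^+ 'C(k, 2)
   * (- Xs ^+ 5) ^+ k * Xs ^+ (6 * n) ^+ (n.*2 - k) * gauss (Xs ^+ 6) n.*2 k)).
rewrite /index_iota subn0 !mulr_sumr; apply: eq_big_seq => k.
rewrite mem_iota add0n ltnS => /andP[_ le_k].
rewrite !mulrA; congr (_ * _); rewrite [(- Xs ^+ 5) ^+ k]exprNn -!exprM.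
have := @qexpE 3 2 (k%:Z - n%:Z) isT; move: (qexp _ _ _) => x xE.
have -> : (-1) ^+ n * Xs ^+ M * (-1) ^+ x * Xs ^+ x
   = (-1) ^+ (n + x) * Xs ^+ (M + x) :> ser by rewrite !exprD; ring.
have -> : Xs ^+ (6 * 'C(k, 2)) * ((-1) ^+ k * Xs ^+ (5 * k)) * Xs ^+ (6 * n * (n.*2 - k))
   = (-1) ^+ k * Xs ^+ (6 * 'C(k, 2) + 5 * k + 6 * n * (n.*2 - k)) :> ser.
  by rewrite !(exprD _ (_ + _)) exprD; ring.
congr (_ * Xs ^+ _).
  (* The signs match because 3j^2 + 2j has the parity of j = k - n. *)
  rewrite -signr_odd -[RHS]signr_odd; congr (_ ^+ nat_of_bool _).
  rewrite expr2 in xE; set j := k%:Z - n%:Z in xE.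
  have : k%:Z = j + n%:Z by rewrite subrK.
  by move: xE; rewrite -[j]zhalvesK; case: (zhalves j) => u /=; lia.
have c2 m : ('C(m, 2) * 2 + m = m * m)%N.
  by elim: m => // m IHm; rewrite binS bin1; lia.
have := c2 k; have := c2 n; rewrite /M expr2 in xE *.
move: ('C(k, 2)) ('C(n, 2)) => ck cn.
have : (n * (n.*2 - k) + n * k = n * n + n * n)%N by rewrite -!mulnDr -addnn subnK // addnn.
by rewrite -!mulnA; move: (n * (_ - _))%N => nd; lia.
Qed.

(** * Agreement of coefficients and passage to the infinite product *)

Definition agree (N : nat) (f g : ser) := forall i, (i < N)%N -> f i = g i.

Lemma agree_refl N f : agree N f f. Proof. by []. Qed.

Lemma agree_sym N f g : agree N f g -> agree N g f.
Proof. by move=> fg i lti; rewrite fg. Qed.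

Lemma agree_trans N f g h : agree N f g -> agree N g h -> agree N f h.
Proof. by move=> fg gh i lti; rewrite fg ?gh. Qed.

Lemma agree_le M N f g : (M <= N)%N -> agree N f g -> agree M f g.
Proof. by move=> leMN fg i lti; apply: fg; lia. Qed.

Lemma agreeM N f1 g1 f2 g2 :
  agree N f1 g1 -> agree N f2 g2 -> agree N (f1 * f2) (g1 * g2).
Proof.
move=> fg1 fg2 i lti; rewrite !serME; apply: eq_bigr => j _; have := ltn_ord j.
by move=> ltj; rewrite fg1 ?fg2 //; lia.
Qed.

Lemma agree_Xn N m f g : agree N f g -> agree (m + N) (Xs ^+ m * f) (Xs ^+ m * g).
Proof. by move=> fg i lti; rewrite !serXnE; case: leqP => // ?; apply: fg; lia. Qed.

Lemma agree_sum N (I : eqType) (r : seq I) (F G : I -> ser) :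
  (forall i, i \in r -> agree N (F i) (G i)) ->
  agree N (\sum_(i <- r) F i) (\sum_(i <- r) G i).
Proof.
move=> FG n ltn; rewrite !ser_sumE; apply: eq_big_seq => i ir.
exact: FG.
Qed.

Definition poly_ser (p : {poly int}) : ser := Ser (fun n => p`_n).

Lemma poly_ser_is_zmod : zmod_morphism poly_ser.
Proof. by move=> p r; apply: serP => n; rewrite serDE serNE /= coefB. Qed.

Lemma poly_ser_is_monoid : monoid_morphism poly_ser.
Proof.
by split=> [|p r]; apply: serP => n /=; rewrite ?coef1 ?coefM.
Qed.

HB.instance Definition _ :=
  GRing.isZmodMorphism.Build {poly int} ser poly_ser poly_ser_is_zmod.
HB.instance Definition _ :=
  GRing.isMonoidMorphism.Build {poly int} ser poly_ser poly_ser_is_monoid.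

Lemma poly_serX : poly_ser 'X = Xs.
Proof. by apply: serP => n /=; rewrite coefX. Qed.

Lemma agree_qpoch r m N : (0 < m)%N ->
  agree N (\prod_(k < N) (1 - Xs ^+ (r + m * k))) (Ser (qpoch r m)).
Proof.
move=> m_gt0 i lti; rewrite /= -(qpochE _ m_gt0 lti).
rewrite -[RHS]/(poly_ser _ i) rmorph_prod /=; congr (coefs _ i).
by apply: eq_bigr => k _; rewrite rmorphB rmorph1 rmorphXn /= poly_serX.
Qed.

Local Notation qp r := (Ser (qpoch r 6)).

Lemma agree_poch N : agree N (poch (Xs ^+ 6) N) (qp 6).
Proof.
have := @agree_qpoch 6 6 N isT; rewrite /poch.
by under [in X in X -> _]eq_bigr do rewrite -mulnS exprM.
Qed.

(** In [gauss_poch] all three finite products agree with (q^6;q^6)_oo below degree N; one such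
    factor is then cancelled by its inverse [D]. *)
Lemma agree_gauss a b N : (N <= a)%N -> (N <= b)%N ->
  agree N (gauss (Xs ^+ 6) (a + b) a * qp 6) 1.
Proof.
move=> leNa leNb; pose D := Ser (fps_inv (qpoch 6 6)).
have DK : qp 6 * D = 1.
  by apply: serP => n; apply: (@fps_mulfV (qpoch 6 6)); rewrite qpoch0.
have pochN m : (N <= m)%N -> agree N (poch (Xs ^+ 6) m) (qp 6).
  by move=> leNm; exact: agree_le leNm (@agree_poch m).
rewrite -[X in agree _ X]mulr1 -DK.
have -> : gauss (Xs ^+ 6) (a + b) a * qp 6 * (qp 6 * D)
   = gauss (Xs ^+ 6) (a + b) a * qp 6 * qp 6 * D by ring.
apply: agreeM (@agree_refl _ _); apply: agree_trans (pochN (a + b)%N _); last by lia.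
rewrite -gauss_poch; apply: agreeM; last exact: agree_sym (pochN _ _).
by apply: agreeM => //; apply: agree_sym (pochN _ _).
Qed.

Lemma triple_product : qp 1 * qp 5 * qp 6 = alt (theta 3 2).
Proof.
apply: serP => i; set n := i.+1.
pose e z := qexp 3 2 z.
have main : agree n (qp 1 * qp 5 * qp 6)
    (\sum_(k <- iota 0 n.*2.+1) (-1) ^+ e (k%:Z - n%:Z) * Xs ^+ e (k%:Z - n%:Z)).
  apply: (@agree_trans _ _ (\prod_(i < n) (1 - Xs ^+ (1 + 6 * i))
           * \prod_(i < n) (1 - Xs ^+ (5 + 6 * i)) * qp 6)).
    apply: agreeM (@agree_refl _ _).
    by apply: agreeM; apply: agree_sym (@agree_qpoch _ _ _ _).
  rewrite finite_triple_product mulr_suml; apply: agree_sum => k.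
  rewrite mem_iota add0n ltnS => /andP[_ le_k].
  rewrite -!mulrA; apply: agreeM; first exact: agree_refl.
  rewrite -[X in agree _ _ X]mulr1.
  (* The Gaussian binomial is under control only below degree [m] = n - |j|, with j = k - n. The
     factor q^e makes up the difference, as e = 3j^2 + 2j >= |j|. *)
  pose m := minn k (n.*2 - k).
  apply: (@agree_le _ (e (k%:Z - n%:Z) + m)).
    rewrite /m /e; have := @qexpE 3 2 (k%:Z - n%:Z) isT; move: (qexp _ _ _) => x.
    rewrite expr2; case: (leqP k n) => [/subnK <-|/ltnW/subnK <-].
      by move: (n - k)%N => d xE; nia.
    by move: (k - n)%N => d xE; nia.
  apply: agree_Xn; rewrite -{1}(subnKC le_k).
  by apply: agree_gauss; rewrite /m; lia.
rewrite (main i) // -(big_map (fun k : nat => k%:Z - n%:Z) xpredT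
   (fun z => (-1) ^+ e z * Xs ^+ e z : ser)) -/(zrange n) ser_sumE.
have coefE z : ((-1) ^+ e z * Xs ^+ e z : ser) i = if e z == i then (-1) ^+ i else 0.
  have -> : (-1) ^+ e z * Xs ^+ e z = alt (Xs ^+ e z) :> ser.
    by rewrite rmorphXn /= altX [(- Xs) ^+ _]exprNn.
  rewrite -[Xs ^+ _]mulr1 [LHS]/= -[fps_mul _ _ _]/((Xs ^+ e z * 1) i) serXnE ser1E.
  rewrite subn_eq0; case: (ltngtP (e z) i) => ? //=; rewrite ?mulr0 ?mulr1 //.
under eq_bigr do rewrite coefE.
by rewrite -big_mkcond -big_filter big_const_seq count_predT iter_addr_0 -mulr_natr.
Qed.

Lemma schurS_theta : alt (theta 3 2) * Ser schurS = 1.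
Proof. by rewrite -triple_product; apply: serP => n; apply: schurS_genfun. Qed.

(** * Congruences *)

Lemma E2X : E2 Xs = Xs ^+ 2. Proof. exact: dilX. Qed.

Definition cong (m : nat) (f g : ser) := exists h, f = g + m%:R * h.

Lemma cong_trans m f g h : cong m f g -> cong m g h -> cong m f h.
Proof. by case=> u -> [v ->]; exists (u + v); ring. Qed.

Lemma cong_sec m k r f g : cong m f g -> cong m (sec k r f) (sec k r g).
Proof. by case=> u ->; exists (sec k r u); rewrite secD secMn. Qed.

Lemma congM m f g f' g' : cong m f g -> cong m f' g' -> cong m (f * f') (g * g').
Proof. by case=> u -> [v ->]; exists (u * g' + g * v + m%:R * u * v); ring. Qed.

Lemma sec21_cong m f u v : cong m f (E2 u + Xs * E2 v) -> cong m (sec 2 1 f) v.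
Proof. by move/(cong_sec 2 1); rewrite sec21_bisect. Qed.

Lemma sec20_cong m f u v : cong m f (E2 u + Xs * E2 v) -> cong m (sec 2 0 f) u.
Proof. by move/(cong_sec 2 0); rewrite sec20_bisect. Qed.

(* In Ramanujan's notation phi3 = phi(q^3), psi6 = psi(q^6), and Q(-q) = Th is
   the denominator of the generating function S. *)
Local Notation P := (theta 3 1).
Local Notation Q := (theta 3 2).
Local Notation phi3 := (dil 3 (theta 1 0)).
Local Notation psi6 := (dil 3 halftheta).
Local Notation Th := (alt Q).
Local Notation phi3' := (alt phi3).
Local Notation S := (Ser schurS).
Local Notation X := Xs.

(** * Bisections and product identities for the theta series *)

Lemma dil4 f : dil 4 f = E2 (E2 f). Proof. by rewrite dil_dil. Qed.

Lemma Q_bisect : Q = E2 (E2 P) + X * E2 (E2 Q).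
Proof. by rewrite {1}theta32_quadrisect !dil4. Qed.

Lemma phi3_bisect : phi3 = E2 (E2 phi3) + 2 * X ^+ 3 * E2 (E2 psi6).
Proof.
rewrite {1}theta10_quadrisect theta11E !dil4 !(rmorphD, rmorphM, rmorph_nat) /= dilX //.
by rewrite -!(@dil_comm 2 3) //; ring.
Qed.

Lemma phi3_sqr : phi3 ^+ 2 = E2 phi3 ^+ 2 + 4 * X ^+ 3 * E2 psi6 ^+ 2.
Proof.
rewrite -[LHS]rmorphXn theta10_sqr theta11E !(rmorphD, rmorphM, rmorph_nat, rmorphXn) /= dilX //.
by rewrite -!(@dil_comm 2 3) //; ring.
Qed.

Lemma Q_phi3 : Q * phi3 = E2 P ^+ 2 + X * E2 Q ^+ 2.
Proof. exact: theta32_mul. Qed.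

Lemma Th_bisect : Th = E2 (E2 P) - X * E2 (E2 Q).
Proof.
by rewrite {1}Q_bisect rmorphD rmorphM /= altX !alt_dil //; ring.
Qed.

Lemma phi3'_bisect : phi3' = E2 (E2 phi3) - 2 * X ^+ 3 * E2 (E2 psi6).
Proof.
by rewrite {1}phi3_bisect !(rmorphD, rmorphM, rmorph_nat, rmorphXn) /= altX !alt_dil //; ring.
Qed.

Lemma phi3'_sqr : phi3' ^+ 2 = E2 phi3 ^+ 2 - 4 * X ^+ 3 * E2 psi6 ^+ 2.
Proof.
rewrite -[LHS]rmorphXn phi3_sqr !(rmorphD, rmorphM, rmorph_nat, rmorphXn) /=.
by rewrite altX !alt_dil //; ring.
Qed.

Lemma Th_phi3' : Th * phi3' = E2 P ^+ 2 - X * E2 Q ^+ 2.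
Proof.
rewrite -[LHS]rmorphM Q_phi3 !(rmorphD, rmorphM, rmorphXn) /=.
by rewrite altX !alt_dil //; ring.
Qed.

(** The factors are conjugate under q -> -q, so the product is a difference of squares; it is
    [Th_phi3'] evaluated at q^2. *)
Lemma Q_Th : Q * Th = E2 (Th * phi3').
Proof.
rewrite Th_phi3' Th_bisect {1}Q_bisect !(rmorphB, rmorphM, rmorphXn) /= E2X; ring.
Qed.

Lemma phi3_phi3' : phi3 * phi3' = E2 (phi3' ^+ 2).
Proof.
rewrite phi3'_sqr phi3'_bisect {1}phi3_bisect !(rmorphB, rmorphM, rmorphXn, rmorph_nat) /= E2X; ring.
Qed.

(** At q^2 the right side is Q Th phi3 phi3', which regroups as (Q phi3)(Th phi3'), again a
    difference of squares. *)
Lemma P4_sub_Q4 : P ^+ 4 - X * Q ^+ 4 = Th * phi3' ^+ 3.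
Proof.
apply: E2_inj; rewrite [in RHS]exprS mulrA rmorphM /= -Q_Th -phi3_phi3'.
rewrite !(rmorphB, rmorphM, rmorphXn) /= E2X.
have -> : Q * Th * (phi3 * phi3') = (Q * phi3) * (Th * phi3') by ring.
by rewrite Q_phi3 Th_phi3'; ring.
Qed.

Lemma ser_divides (f : ser) m : (forall n, exists k, f n = m%:R * k) ->
  exists h, f = m%:R * h.
Proof.
move=> /choice[h hP]; exists (Ser h); apply: serP => n.
by rewrite ser_natmulE hP.
Qed.

(** By the quadrisection, a coefficient at n > 0 is, up to an even number, zero or the coefficient
    at n / 4; strong induction concludes. *)
Lemma theta10_odd : exists s, theta 1 0 = 1 + 2 * s.
Proof.
suff [h hE] : exists h, theta 1 0 - 1 = 2 * h by exists h; rewrite -hE; ring.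
have E : theta 1 0 = dil 4 (theta 1 0) + 2 * (X * dil 4 halftheta).
  by rewrite {1}theta10_quadrisect theta11E rmorphM rmorph_nat; ring.
apply: ser_divides => n; elim/ltn_ind: n => -[|n] IHn; first by exists 0.
rewrite serDE serNE ser1E E serDE ser_natmulE dilE oppr0 addr0.
move: ((X * _) _) => r; case: ifP => [/divnK def_n|_]; last by exists r; rewrite add0r.
have [|k] := IHn (n.+1 %/ 4)%N; first by rewrite ltn_Pdiv.
rewrite serDE serNE ser1E; case: eqP def_n => [-> //|_ _]; rewrite oppr0 addr0 => ->.
by exists (k + r); rewrite mulrDr.
Qed.

Lemma phi3_odd : exists s, phi3 = 1 + 2 * s.
Proof.
have [s ->] := theta10_odd; exists (dil 3 s).
by rewrite rmorphD rmorphM rmorph_nat rmorph1.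
Qed.

Lemma phi3_pow4 : cong 8 (phi3 ^+ 4) 1.
Proof.
by have [s ->] := phi3_odd; exists (s + 3 * s ^+ 2 + 4 * s ^+ 3 + 2 * s ^+ 4); ring.
Qed.

Lemma phi3'_odd : exists s, phi3' = 1 + 2 * s.
Proof.
have [s ->] := phi3_odd; exists (alt s).
by rewrite rmorphD rmorphM rmorph_nat rmorph1.
Qed.

Lemma ser_inv (f : ser) : f 0%N = 1 -> exists g, f * g = 1.
Proof.
by move=> f0; exists (Ser (fps_inv f)); apply: serP => n; apply: fps_mulfV.
Qed.

Lemma phi3'_inv : exists w, phi3' * w = 1.
Proof. by apply: ser_inv. Qed.

(** Coordinates of the bisections Q^2 = E2 Z + 2 X E2 b and phi3 = E2 c + 2 X^3 E2 d. *)
Local Notation Z := (Q * phi3).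
Local Notation b := (E2 (P * Q)).
Local Notation c := (E2 phi3).
Local Notation d := (E2 psi6).

Lemma Q_sqr : Q ^+ 2 = E2 Z + 2 * X * E2 b.
Proof.
rewrite Q_phi3 {1}Q_bisect !(rmorphD, rmorphM, rmorphXn) /= E2X; ring.
Qed.

Lemma Q_mod2 : cong 2 (Q ^+ 2) (E2 Q).
Proof.
have [s sE] := phi3_odd; rewrite Q_sqr sE; exists (E2 (Q * s) + X * E2 b).
by rewrite !(rmorphD, rmorphM, rmorph_nat, rmorph1) /=; ring.
Qed.

(** Both sides are the even part of Q phi3: one read off [Q_phi3], the other obtained by multiplying
    the bisections of the factors. *)
Lemma P_sqr : P ^+ 2 = E2 P * E2 phi3 + 2 * X ^+ 2 * E2 Q * E2 psi6.
Proof.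
have := congr1 (sec 2 0) Q_phi3; rewrite -!rmorphXn sec20_bisect /= => <-.
rewrite -(sec20_bisect (E2 P * E2 phi3 + 2 * X ^+ 2 * E2 Q * E2 psi6)
  (E2 Q * E2 phi3 + 2 * X * E2 P * E2 psi6)).
congr (sec 2 0 _); rewrite {1}Q_bisect {1}phi3_bisect.
by rewrite !(rmorphD, rmorphM, rmorphXn, rmorph_nat) /= E2X; ring.
Qed.

Lemma ser_natmulI m : (0 < m)%N -> injective (fun f : ser => m%:R * f).
Proof.
move=> m_gt0 f g /= fg; apply: serP => n.
have := congr1 (fun h : ser => h n) fg; rewrite !ser_natmulE.
by apply: mulfI; lia.
Qed.

(** Two expansions of phi3^2 are compared, the square of [phi3_bisect] and [phi3_sqr] used twice.
    Their odd parts are 4 X^3 times the two sides taken at q^2. *)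
Lemma psi6_sqr : psi6 ^+ 2 = E2 (phi3 * psi6).
Proof.
apply: (@ser_natmulI 4 isT); apply: (@XsnI 1); apply: E2_inj; apply: (@XsnI 1).
have : phi3 ^+ 2 = E2 (phi3 ^+ 2) + 4 * X ^+ 3 * E2 (psi6 ^+ 2).
  by rewrite {1}phi3_sqr !rmorphXn.
rewrite {2}phi3_sqr {1}phi3_bisect => fE.
apply: (@addrI _ (E2 (E2 phi3 ^+ 2 + 4 * X ^+ 3 * E2 psi6 ^+ 2))).
move: fE; rewrite !(rmorphD, rmorphM, rmorphXn, rmorph_nat) /= E2X => fE.
transitivity (E2 (E2 phi3) ^+ 2 + 4 * (X ^+ 2) ^+ 3 * E2 (E2 psi6) ^+ 2
  + 4 * X ^+ 3 * E2 psi6 ^+ 2); first by ring.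
by rewrite -fE; ring.
Qed.

(** * The subsequence S(4n+3) *)

Section WithInverse.
Variable w : ser.
Hypothesis wK : phi3' * w = 1.

(** 1 / Th = Q / (Q Th), and by [Q_Th] the new denominator is a series in q^2. The recursion for [w]
    has the same origin in [phi3_phi3']. *)
Lemma S_rec : S = Q * E2 (S * w).
Proof.
transitivity (S * E2 (Th * S * (phi3' * w))).
  by rewrite schurS_theta wK mulr1 rmorph1 mulr1.
have -> : Th * S * (phi3' * w) = (Th * phi3') * (S * w) by ring.
rewrite rmorphM /= -Q_Th; transitivity (Th * S * (Q * E2 (S * w))); first by ring.
by rewrite schurS_theta mul1r.
Qed.

Lemma inv_rec : w = phi3 * E2 (w ^+ 2).
Proof.
transitivity (w * E2 ((phi3' * w) ^+ 2)); first by rewrite wK expr1n rmorph1 mulr1.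
rewrite exprMn rmorphM /= -phi3_phi3'.
transitivity (phi3' * w * (phi3 * E2 (w ^+ 2))); first by ring.
by rewrite wK mul1r.
Qed.

Lemma S_quad : S = Q * E2 Z * E2 (E2 (S * w ^+ 3)).
Proof.
rewrite {1}S_rec {1}S_rec {2}inv_rec !(rmorphM, rmorphXn) /=; ring.
Qed.

(** In [S_quad] only Q and then Z remain to be bisected; their odd halves are E2 Q and Q^2. *)
Lemma sec43_S : sec 2 1 (sec 2 1 S) = Q ^+ 3 * (S * w ^+ 3).
Proof.
have -> : sec 2 1 S = E2 Q * Z * E2 (S * w ^+ 3).
  rewrite -(sec21_bisect (E2 P * Z * E2 (S * w ^+ 3)) (E2 Q * Z * E2 (S * w ^+ 3))).
  by congr (sec 2 1 _); rewrite {1}S_quad {1}Q_bisect !(rmorphM, rmorphXn) /=; ring.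
rewrite -[RHS](sec21_bisect (Q * P ^+ 2 * (S * w ^+ 3))).
by congr (sec 2 1 _); rewrite Q_phi3 !(rmorphM, rmorphXn) /=; ring.
Qed.

(** All inverses now sit in a series in q^2, which leaves only Q^4 phi3^3 to bisect. *)
Lemma T_quartic : Q ^+ 3 * (S * w ^+ 3) = Q ^+ 4 * phi3 ^+ 3 * E2 (S * w ^+ 7).
Proof.
rewrite {1}S_rec {2}inv_rec !(rmorphM, rmorphXn) /=; ring.
Qed.

Lemma S_mul_inv : S * w = Z * E2 (S * w ^+ 3).
Proof. rewrite {1}S_rec {2}inv_rec !(rmorphM, rmorphXn) /=; ring. Qed.

Lemma inv_pow6 : cong 16 (w ^+ 6) (phi3' ^+ 2).
Proof.
have [s sE] := phi3'_odd.
(* [t] is ((1 + 2s)^8 - 1) / 16. *)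
pose t := s + 7 * s ^+ 2 + 28 * s ^+ 3 + 70 * s ^+ 4 + 112 * s ^+ 5
  + 112 * s ^+ 6 + 64 * s ^+ 7 + 16 * s ^+ 8.
have e8 : phi3' ^+ 8 = 1 + 16 * t by rewrite sE /t; ring.
exists (- t * w ^+ 6).
transitivity (w ^+ 6 * phi3' ^+ 8 - 16 * t * w ^+ 6); first by rewrite e8; ring.
have -> : w ^+ 6 * phi3' ^+ 8 = (phi3' * w) ^+ 6 * phi3' ^+ 2 by ring.
by rewrite wK expr1n; ring.
Qed.

End WithInverse.

(** Together with [odd_factor], the two halves of Q^4 phi3^3 in the coordinates of the bisections of
    Q^2 and phi3; see [cube_bisect]. *)
Definition even_factor (z b c d : ser) : ser :=
  (z ^+ 2 + 4 * X * b ^+ 2) * (c ^+ 3 + 12 * X ^+ 3 * c * d ^+ 2)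
  + 4 * X * z * b * (6 * X * c ^+ 2 * d + 8 * X ^+ 4 * d ^+ 3).

Definition odd_factor (z b c d : ser) : ser :=
  (z ^+ 2 + 4 * X * b ^+ 2) * (6 * X * c ^+ 2 * d + 8 * X ^+ 4 * d ^+ 3)
  + 4 * z * b * (c ^+ 3 + 12 * X ^+ 3 * c * d ^+ 2).

Lemma cube_bisect (q2 f z b c d u : ser) :
  q2 = E2 z + 2 * X * E2 b -> f = E2 c + 2 * X ^+ 3 * E2 d ->
  q2 ^+ 2 * f ^+ 3 * E2 u
  = E2 (even_factor z b c d * u) + X * E2 (odd_factor z b c d * u).
Proof.
move=> -> ->; rewrite /even_factor /odd_factor.
by rewrite !(rmorphD, rmorphM, rmorphXn, rmorph_nat) /= E2X; ring.
Qed.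

Section Factors.
Variables p r f y : ser.
Local Notation z := (E2 p ^+ 2 + X * E2 r ^+ 2).
Local Notation b := (E2 (p * r)).
Local Notation c := (E2 f).
Local Notation d := (E2 y).
Local Notation g := (E2 f ^+ 2 - 4 * X ^+ 3 * E2 y ^+ 2).
(** Expanded, this is E2(p^6 + 7 X p^2 r^4) + X E2(7 p^4 r^2 + X r^6), the source of the sevens
    below. *)
Local Notation a3 := (z ^+ 3 + 4 * X * b ^+ 2 * z).

(** The multiplier z g stands for Z phi3'^2, which is what S w^7 contributes modulo 16 besides a
    series in q^2. *)
Lemma odd_factor_bisect :
  cong 16 (odd_factor z b c d * (z * g))
   (E2 (6 * X * f ^+ 4 * y * (7 * p ^+ 4 * r ^+ 2 + X * r ^+ 6)
        + 4 * f ^+ 5 * p * r * (p ^+ 4 + X * r ^+ 4))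
    + X * E2 (6 * f ^+ 4 * y * (p ^+ 6 + 7 * X * p ^+ 2 * r ^+ 4)
        + 8 * f ^+ 5 * p ^+ 3 * r ^+ 3)).
Proof.
exists (- a3 * (X ^+ 4 * c ^+ 2 * d ^+ 3 + 2 * X ^+ 7 * d ^+ 5)
  + b * z ^+ 2 * (2 * X ^+ 3 * c ^+ 3 * d ^+ 2 - 12 * X ^+ 6 * c * d ^+ 4)).
rewrite /odd_factor !(rmorphD, rmorphM, rmorphXn, rmorph_nat) /= E2X.
by move: (E2 p) (E2 r) (E2 f) (E2 y) X => p' r' f' y' x; ring.
Qed.

Lemma even_factor_bisect :
  cong 16 (even_factor z b c d * (z * g))
   (E2 (f ^+ 5 * (p ^+ 6 + 7 * X * p ^+ 2 * r ^+ 4)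
        + 8 * X ^+ 2 * f ^+ 3 * y ^+ 2 * (7 * p ^+ 4 * r ^+ 2 + X * r ^+ 6)
        + 8 * X * p * r * f ^+ 4 * y * (p ^+ 4 + X * r ^+ 4))
    + X * E2 (f ^+ 5 * (7 * p ^+ 4 * r ^+ 2 + X * r ^+ 6)
        + 8 * X * f ^+ 3 * y ^+ 2 * (p ^+ 6 + 7 * X * p ^+ 2 * r ^+ 4))).
Proof.
exists (- 3 * X ^+ 6 * c * d ^+ 4 * a3 + X ^+ 2 * b * c ^+ 4 * d * z ^+ 2
  - 4 * X ^+ 5 * b * c ^+ 2 * d ^+ 3 * z ^+ 2 - 8 * X ^+ 8 * b * d ^+ 5 * z ^+ 2
  + X ^+ 3 * b * c ^+ 4 * d * E2 (p ^+ 2 * r ^+ 2)).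
rewrite /even_factor !(rmorphD, rmorphM, rmorphXn, rmorph_nat) /= E2X.
by move: (E2 p) (E2 r) (E2 f) (E2 y) X => p' r' f' y' x; ring.
Qed.
End Factors.

Section WithInverse.
Variable w : ser.
Hypothesis wK : phi3' * w = 1.
Local Notation T := (Q ^+ 3 * (S * w ^+ 3)).
Local Notation k0 := (S * w ^+ 3).

Lemma T_bisect :
  T = E2 (even_factor Z b c d * (S * w ^+ 7)) + X * E2 (odd_factor Z b c d * (S * w ^+ 7)).
Proof.
rewrite (T_quartic wK) -(cube_bisect _ Q_sqr phi3_bisect); ring.
Qed.

Lemma S_mul_inv7 : cong 16 (S * w ^+ 7) (Z * phi3' ^+ 2 * E2 k0).
Proof.
have -> : S * w ^+ 7 = S * w * w ^+ 6 by ring.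
rewrite (S_mul_inv wK); have [h ->] := inv_pow6 wK.
by exists (Z * E2 k0 * h); ring.
Qed.

(** [k0] inverts Th phi3'^3; in this form it cancels against the factor P^4 - X Q^4 in the
    bisections. *)
Lemma k0_inv : k0 * (P ^+ 4 - X * Q ^+ 4) = 1.
Proof.
rewrite P4_sub_Q4; transitivity ((Th * S) * (phi3' * w) ^+ 3); first by ring.
by rewrite wK schurS_theta expr1n mulr1.
Qed.

(** Modulo 2, w is 1 and Th is Q, so [k0] reduces to 1 / Q. *)
Lemma k0_mod2 : cong 2 (k0 * Q) 1.
Proof.
have [s sE] := phi3'_odd.
have [v wE] : cong 2 w 1.
  exists (- s * w); transitivity (phi3' * w - 2 * s * w); first by rewrite sE; ring.
  by rewrite wK; ring.
have QE : Q = Th + 2 * X * E2 (E2 Q) by rewrite Th_bisect {1}Q_bisect; ring.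
exists (k0 * X * E2 (E2 Q) + 3 * v + 6 * v ^+ 2 + 4 * v ^+ 3).
rewrite {1}QE; transitivity (Th * S * w ^+ 3 + 2 * (k0 * X * E2 (E2 Q))); first by ring.
by rewrite schurS_theta {1}wE; ring.
Qed.

Lemma sec21_oddT :
  cong 16 (sec 2 1 (sec 2 1 T)) (6 * psi6 * P ^+ 2 + 8 * P ^+ 3 * Q ^+ 2).
Proof.
rewrite T_bisect sec21_bisect.
have [h hE] := S_mul_inv7; have := odd_factor_bisect P Q phi3 psi6; rewrite -Q_phi3 -phi3'_sqr => -[j jE].
have : cong 16 (odd_factor Z b c d * (S * w ^+ 7))
   (E2 ((6 * X * phi3 ^+ 4 * psi6 * (7 * P ^+ 4 * Q ^+ 2 + X * Q ^+ 6)
        + 4 * phi3 ^+ 5 * P * Q * (P ^+ 4 + X * Q ^+ 4)) * k0)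
    + X * E2 ((6 * phi3 ^+ 4 * psi6 * (P ^+ 6 + 7 * X * P ^+ 2 * Q ^+ 4)
        + 8 * phi3 ^+ 5 * P ^+ 3 * Q ^+ 3) * k0)).
  exists (j * E2 k0 + odd_factor Z b c d * h); rewrite hE.
  transitivity (odd_factor Z b c d * (Z * phi3' ^+ 2) * E2 k0 + 16 * (odd_factor Z b c d * h)).
    by ring.
  by rewrite jE ![E2 (_ * k0)]rmorphM /=; ring.
move/sec21_cong/cong_trans; apply.
have [t tE] := phi3_pow4; have [v vE] := k0_mod2; have [s sE] := phi3_odd.
set A := P ^+ 4 - X * Q ^+ 4; have kA : k0 * A = 1 := k0_inv.
have vE' : k0 * Q = 1 + 2 * v := vE; have tE' : phi3 ^+ 4 = 1 + 8 * t := tE.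
exists (3 * psi6 * P ^+ 2 * t + 3 * phi3 ^+ 4 * psi6 * X * P ^+ 2 * Q ^+ 4 * k0
   + P ^+ 3 * Q ^+ 2 * v * phi3 ^+ 5 + P ^+ 3 * Q ^+ 2 * (s + 4 * t * phi3)).
(* P^6 + 7 X P^2 Q^4 = P^2 A + 8 X P^2 Q^4, so k0 A = 1 removes [k0]; in the term with coefficient
   8, knowing k0 Q modulo 2 is enough. *)
transitivity (6 * phi3 ^+ 4 * psi6 * P ^+ 2 * (k0 * A)
  + 16 * (3 * phi3 ^+ 4 * psi6 * X * P ^+ 2 * Q ^+ 4 * k0)
  + 8 * (phi3 ^+ 4 * phi3) * P ^+ 3 * Q ^+ 2 * (k0 * Q)); first by rewrite /A; ring.
rewrite kA vE'.
have f5 : phi3 ^+ 5 = 1 + 2 * (s + 4 * t * phi3).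
  by rewrite exprS tE' mulrDr mulr1 {1}sE; ring.
have -> : phi3 ^+ 4 * phi3 = phi3 ^+ 5 by ring.
transitivity (6 * psi6 * P ^+ 2 * phi3 ^+ 4 + 8 * P ^+ 3 * Q ^+ 2 * phi3 ^+ 5
  + 16 * (3 * phi3 ^+ 4 * psi6 * X * P ^+ 2 * Q ^+ 4 * k0 + P ^+ 3 * Q ^+ 2 * v * phi3 ^+ 5)).
  by ring.
by rewrite {1}tE' {1}f5; ring.
Qed.

Lemma P_mod2 : cong 2 (P ^+ 2) (E2 P).
Proof.
have [s sE] := phi3_odd; exists (E2 P * E2 s + X ^+ 2 * E2 Q * E2 psi6).
rewrite P_sqr sE !(rmorphD, rmorphM, rmorph_nat, rmorph1) /=; ring.
Qed.

Lemma psi6_mod2 : cong 2 (psi6 ^+ 2) (E2 psi6).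
Proof.
have [s sE] := phi3_odd; exists (E2 s * E2 psi6).
rewrite psi6_sqr sE !(rmorphD, rmorphM, rmorph_nat, rmorph1) /=; ring.
Qed.

Lemma psi6_even : psi6 = E2 (sec 2 0 psi6).
Proof.
by rewrite {1}halftheta_even -dil_comm // -{1}[dil 3 _]sec20E dil_comm // -halftheta_even.
Qed.

Lemma sec21_E2M u v : sec 2 1 (E2 u * v) = u * sec 2 1 v.
Proof. by rewrite sec21M sec20E sec21E mul0r addr0. Qed.

Lemma sec21_sqr u : cong 2 (sec 2 1 (u ^+ 2)) 0.
Proof.
by exists (sec 2 0 u * sec 2 1 u); rewrite expr2 sec21M; ring.
Qed.

(** P and psi6 are series in q^2, so odd exponents come only from Q^2 in the term with coefficient
    8, and the odd part of a square is even. *)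
Lemma T_7mod8 : cong 16 (sec 2 1 (sec 2 1 (sec 2 1 T))) 0.
Proof.
apply: cong_trans (cong_sec 2 1 sec21_oddT) _.
pose g := sec 2 0 P; pose e := sec 2 0 psi6.
have -> : 6 * psi6 * P ^+ 2 + 8 * P ^+ 3 * Q ^+ 2
    = E2 (6 * e * g ^+ 2) + E2 (8 * g ^+ 3) * Q ^+ 2.
  by rewrite {1}psi6_even {1 2}theta31_even !(rmorphM, rmorphXn, rmorph_nat).
rewrite secD sec21E add0r sec21_E2M; have [h ->] := sec21_sqr Q.
by exists (g ^+ 3 * h); ring.
Qed.

Lemma sec21_evenT :
  cong 16 (sec 2 1 (sec 2 0 T))
    (7 * (phi3 ^+ 5 * Q ^+ 2) + 8 * X * Q ^+ 5 + 8 * X * psi6 ^+ 2 * P ^+ 2).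
Proof.
rewrite T_bisect sec20_bisect.
have [h hE] := S_mul_inv7; have := even_factor_bisect P Q phi3 psi6; rewrite -Q_phi3 -phi3'_sqr => -[j].
set u := _ + _ * (P ^+ 4 + X * Q ^+ 4) => jE.
have : cong 16 (even_factor Z b c d * (S * w ^+ 7))
   (E2 (u * k0) + X * E2 ((phi3 ^+ 5 * (7 * P ^+ 4 * Q ^+ 2 + X * Q ^+ 6)
        + 8 * X * phi3 ^+ 3 * psi6 ^+ 2 * (P ^+ 6 + 7 * X * P ^+ 2 * Q ^+ 4)) * k0)).
  exists (j * E2 k0 + even_factor Z b c d * h); rewrite hE.
  transitivity (even_factor Z b c d * (Z * phi3' ^+ 2) * E2 k0 + 16 * (even_factor Z b c d * h)).
    by ring.
  by rewrite jE ![E2 (_ * k0)]rmorphM /=; ring.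
move/sec21_cong/cong_trans; apply.
have [v vE] := k0_mod2; have [s sE] := phi3_odd.
set A := P ^+ 4 - X * Q ^+ 4; have kA : k0 * A = 1 := k0_inv.
have vE' : k0 * Q = 1 + 2 * v := vE.
have [f5 f5E] : exists t, phi3 ^+ 5 = 1 + 2 * t.
  by exists (5 * s + 20 * s ^+ 2 + 40 * s ^+ 3 + 40 * s ^+ 4 + 16 * s ^+ 5); rewrite sE; ring.
have [f2 f2E] : exists t, phi3 ^+ 3 = 1 + 2 * t.
  by exists (3 * s + 6 * s ^+ 2 + 4 * s ^+ 3); rewrite sE; ring.
exists (X * Q ^+ 5 * f5 + X * Q ^+ 5 * phi3 ^+ 5 * v
  + X * psi6 ^+ 2 * P ^+ 2 * f2 + 4 * X ^+ 2 * phi3 ^+ 3 * psi6 ^+ 2 * P ^+ 2 * Q ^+ 4 * k0).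
(* Here 7 P^4 Q^2 + X Q^6 = 7 Q^2 A + 8 X Q^6, and the other bracket is P^2 A + 8 X P^2 Q^4. *)
transitivity (7 * phi3 ^+ 5 * Q ^+ 2 * (k0 * A) + 8 * X * Q ^+ 5 * phi3 ^+ 5 * (k0 * Q)
  + 8 * X * phi3 ^+ 3 * psi6 ^+ 2 * P ^+ 2 * (k0 * A)
  + 64 * (X ^+ 2 * phi3 ^+ 3 * psi6 ^+ 2 * P ^+ 2 * Q ^+ 4 * k0)); first by rewrite /A; ring.
rewrite kA vE'.
transitivity (7 * phi3 ^+ 5 * Q ^+ 2 + 8 * X * Q ^+ 5 * phi3 ^+ 5
  + 8 * X * psi6 ^+ 2 * P ^+ 2 * phi3 ^+ 3
  + 16 * (X * Q ^+ 5 * phi3 ^+ 5 * v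
  + 4 * X ^+ 2 * phi3 ^+ 3 * psi6 ^+ 2 * P ^+ 2 * Q ^+ 4 * k0)); first by ring.
by rewrite {2}f5E {1}f2E; ring.
Qed.
End WithInverse.

(** * The series F *)

Local Notation F := (phi3 ^+ 5 * Q ^+ 2).

(** Writing f^5 as (f^2)^2 f keeps the powers of f at q^2 whole, so only f and q2 are bisected. *)
Lemma quintic_bisect (q2 f y z b c d : ser) :
  q2 = E2 z + 2 * X * E2 b -> f = E2 c + 2 * X ^+ 3 * E2 d ->
  f ^+ 2 = E2 f ^+ 2 + 4 * X ^+ 3 * E2 y ^+ 2 ->
  cong 16 (f ^+ 5 * q2)
    (E2 (f ^+ 4 * (z * c + 4 * X ^+ 2 * b * d))
     + X * E2 (f ^+ 4 * (2 * b * c + 2 * X * z * d) + 8 * X * f ^+ 2 * y ^+ 2 * z * c)).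
Proof.
move=> q2E fE f2E.
exists (2 * X ^+ 3 * E2 (f ^+ 2 * y ^+ 2 * X ^+ 2 * b * d)
  + X ^+ 4 * E2 (f ^+ 2 * y ^+ 2 * (b * c + X * z * d))
  + X ^+ 6 * E2 y ^+ 4 * ((E2 c + 2 * X ^+ 3 * E2 d) * (E2 z + 2 * X * E2 b))).
transitivity ((E2 f ^+ 2 + 4 * X ^+ 3 * E2 y ^+ 2) ^+ 2
  * ((E2 c + 2 * X ^+ 3 * E2 d) * (E2 z + 2 * X * E2 b))).
  by rewrite -f2E -fE -q2E; ring.
rewrite !(rmorphD, rmorphM, rmorphXn, rmorph_nat) /= E2X.
by move: (E2 f) (E2 y) (E2 z) (E2 b) (E2 c) (E2 d) X => *; ring.
Qed.

Lemma F_bisect :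
  cong 16 F (E2 (phi3 ^+ 4 * (Z * c + 4 * X ^+ 2 * b * d))
     + X * E2 (phi3 ^+ 4 * (2 * b * c + 2 * X * Z * d)
               + 8 * X * phi3 ^+ 2 * psi6 ^+ 2 * Z * c)).
Proof. exact: quintic_bisect Q_sqr phi3_bisect phi3_sqr. Qed.

Lemma sec21_evenF : cong 16 (sec 2 1 (sec 2 0 F)) (F + 8 * X * psi6 ^+ 2 * P ^+ 2).
Proof.
have : cong 16 (sec 2 1 (sec 2 0 F)) (F + 8 * X * phi3 ^+ 3 * psi6 ^+ 2 * P ^+ 2).
  apply: cong_trans (cong_sec 2 1 (sec20_cong F_bisect)) _.
  apply: (@sec21_cong _ _ (phi3 ^+ 5 * P ^+ 2 + 4 * X * P * Q * psi6 * phi3 ^+ 4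
    + 8 * X ^+ 2 * phi3 ^+ 3 * psi6 ^+ 2 * Q ^+ 2)).
  exists (X ^+ 6 * d ^+ 4 * (Z * c + 4 * X ^+ 2 * b * d) + 2 * X ^+ 5 * c ^+ 2 * d ^+ 3 * b).
  have -> : phi3 ^+ 4 = (phi3 ^+ 2) ^+ 2 by ring.
  rewrite {1}phi3_sqr Q_phi3 !(rmorphD, rmorphM, rmorphXn, rmorph_nat) /= E2X.
  by move: (E2 phi3) (E2 psi6) (E2 P) (E2 Q) X => *; ring.
move/cong_trans; apply; have [s sE] := phi3_odd.
exists (X * (3 * s + 6 * s ^+ 2 + 4 * s ^+ 3) * psi6 ^+ 2 * P ^+ 2).
have fE : phi3 ^+ 3 = 1 + 2 * (3 * s + 6 * s ^+ 2 + 4 * s ^+ 3) by rewrite sE; ring.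
by rewrite {1}fE; ring.
Qed.

(** As for T: with psi6 = E2 e and P = E2 g, the only factor not in q^2 is e^2, and it carries the
    coefficient 8. *)
Lemma F_7mod8 : cong 16 (sec 2 1 (sec 2 1 (sec 2 1 F))) 0.
Proof.
pose g := sec 2 0 P; pose e := sec 2 0 psi6.
have : cong 16 (sec 2 1 (sec 2 1 F)) (2 * P ^+ 2 * psi6 + 8 * e ^+ 2 * P ^+ 2).
  apply: cong_trans (cong_sec 2 1 (sec21_cong F_bisect)) _.
  apply: (@sec21_cong _ _ (2 * P * Q * phi3 + 2 * X * Q ^+ 2 * psi6 + 8 * X * e ^+ 2 * Q ^+ 2)).
  have [s sE] := phi3_odd; have [t tE] := phi3_pow4.
  have tE' : phi3 ^+ 4 = 1 + 8 * t := tE.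
  have [v vE] : exists v, phi3 ^+ 2 * c = 1 + 2 * v.
    exists (2 * s + 2 * s ^+ 2 + (1 + 2 * s) ^+ 2 * E2 s).
    by rewrite sE !(rmorphD, rmorphM, rmorph_nat, rmorph1) /=; ring.
  exists (t * (b * c + X * Z * d) + X * psi6 ^+ 2 * Z * v).
  transitivity (phi3 ^+ 4 * (2 * b * c + 2 * X * Z * d) + 8 * X * psi6 ^+ 2 * Z * (phi3 ^+ 2 * c)).
    by ring.
  rewrite vE tE'.
  transitivity (2 * b * c + 2 * X * Z * d + 8 * X * psi6 ^+ 2 * Z
    + 16 * (t * (b * c + X * Z * d) + X * psi6 ^+ 2 * Z * v)); first by ring.
  congr (_ + _); rewrite Q_phi3 {2}psi6_even -/e.
  by rewrite !(rmorphD, rmorphM, rmorphXn, rmorph_nat) /= E2X; ring.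
move/(cong_sec 2 1)/cong_trans; apply.
have -> : 2 * P ^+ 2 * psi6 + 8 * e ^+ 2 * P ^+ 2
    = E2 (2 * g ^+ 2 * e) + E2 (8 * g ^+ 2) * e ^+ 2.
  rewrite {1}psi6_even -/e {1 2}theta31_even -/g !(rmorphM, rmorphXn, rmorph_nat) /=; ring.
rewrite secD sec21E add0r sec21_E2M; have [h ->] := sec21_sqr e.
by exists (g ^+ 2 * h); ring.
Qed.

(** * Iteration of U *)

Definition U (f : ser) : ser := sec 2 1 (sec 2 0 f).

Lemma UE f n : U f n = f (4 * n + 2)%N.
Proof. by rewrite !secE; congr (f _); lia. Qed.

Lemma iter_UE a f n : iter a U f n = f (iter a (fun k => 4 * k + 2)%N n).
Proof. by elim: a n => // a IHa n; rewrite iterS UE IHa iterSr. Qed.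

(** The map k -> 4k + 2 fixes -2/3, so each step multiplies 3k + 2 by 4. *)
Lemma iter_index a n : (3 * iter a (fun k => 4 * k + 2) n + 2 = 4 ^ a * (3 * n + 2))%N.
Proof. by elim: a => [|a IHa]; rewrite ?mul1n // iterS expnS; lia. Qed.

(* The coefficients of f at 8n + 7 only depend on 7 F, and the correction term
   reproduces itself under U. *)
Definition orbit_form (f : ser) := exists al be,
  cong 16 f (7 * F + 8 * (E2 (E2 al) + X * E2 (E2 be) + X ^+ 2 * E2 (E2 (E2 Q)))).

(** Modulo 2 squaring replaces q by q^2, and psi6 and P are already series in q^2. *)
Lemma yP_form : cong 2 (psi6 ^+ 2 * P ^+ 2) (E2 (E2 (sec 2 0 psi6 * sec 2 0 P))).
Proof.
have -> : E2 (E2 (sec 2 0 psi6 * sec 2 0 P)) = E2 psi6 * E2 P.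
  by rewrite !rmorphM /= -psi6_even -theta31_even.
exact: congM psi6_mod2 P_mod2.
Qed.

(** U keeps the exponents 2 mod 4, hence sends the correction to E2 Q, whose bisection contains the
    last summand again. The term 8 q psi6^2 P^2 from U F has exponents 1 mod 4 up to multiples of
    16. *)
Lemma orbit_form_U f : orbit_form f -> orbit_form (U f).
Proof.
case=> al [be fE]; exists (E2 P), (sec 2 0 psi6 * sec 2 0 P).
apply: cong_trans (cong_sec 2 1 (cong_sec 2 0 fE)) _.
have -> : sec 2 1 (sec 2 0 (7 * F
    + 8 * (E2 (E2 al) + X * E2 (E2 be) + X ^+ 2 * E2 (E2 (E2 Q)))))
  = 7 * U F + 8 * E2 Q.
  rewrite !secD !secMn; congr (_ + 8 * _).
  have -> : E2 (E2 al) + X * E2 (E2 be) + X ^+ 2 * E2 (E2 (E2 Q))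
     = E2 (E2 al + X * E2 (E2 Q)) + X * E2 (E2 be).
    by rewrite rmorphD rmorphM /= E2X; ring.
  by rewrite sec20_bisect sec21_bisect.
have [h hE] := sec21_evenF; have [j jE] := yP_form.
exists (7 * h + 3 * X * psi6 ^+ 2 * P ^+ 2 + X * j).
have EQ : E2 Q = E2 (E2 (E2 P)) + X ^+ 2 * E2 (E2 (E2 Q)).
  by rewrite {1}Q_bisect rmorphD rmorphM /= E2X.
rewrite {1}/U hE {1}EQ.
transitivity (7 * F + 8 * X * (psi6 ^+ 2 * P ^+ 2)
  + 8 * (E2 (E2 (E2 P)) + X ^+ 2 * E2 (E2 (E2 Q)))
  + 16 * (7 * h + 3 * X * psi6 ^+ 2 * P ^+ 2)); first by ring.
by rewrite {1}jE; ring.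
Qed.

Section WithInverse.
Variable w : ser.
Hypothesis wK : phi3' * w = 1.
Local Notation T := (Q ^+ 3 * (S * w ^+ 3)).

Lemma orbit_form_UT : orbit_form (U T).
Proof.
(* Modulo 2, X Q^5 is X Q E2(E2 Q). Bisecting the factor Q gives the P Q part and X^2 E2(E2(Q^2)),
   which is the last summand because Q^2 reduces to E2 Q. *)
exists 0, (P * Q + sec 2 0 psi6 * sec 2 0 P).
apply: cong_trans (sec21_evenT wK) _.
have [i iE] := Q_mod2; have [j jE] := yP_form.
have Q2E : Q ^+ 2 = E2 Q + 2 * i := iE.
have [k kE] : cong 2 (Q ^+ 4) (E2 (E2 Q)).
  exists (2 * i * E2 Q + 2 * i ^+ 2 + E2 i); have -> : Q ^+ 4 = (Q ^+ 2) ^+ 2 by ring.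
  transitivity (E2 (Q ^+ 2) + 4 * i * E2 Q + 4 * i ^+ 2).
    by rewrite {1}Q2E rmorphXn /=; ring.
  by rewrite Q2E rmorphD rmorphM rmorph_nat /=; ring.
have Q4E : Q ^+ 4 = E2 (E2 Q) + 2 * k := kE.
exists (X * Q * k + X * j + X ^+ 2 * E2 (E2 i)).
transitivity (7 * F + 8 * X * Q * Q ^+ 4 + 8 * X * (psi6 ^+ 2 * P ^+ 2)); first by ring.
rewrite {1}jE {1}Q4E.
transitivity (7 * F + 8 * X * (Q * E2 (E2 Q)) + 16 * (X * Q * k)
  + 8 * X * E2 (E2 (sec 2 0 psi6 * sec 2 0 P)) + 16 * (X * j)); first by ring.
have -> : Q * E2 (E2 Q) = E2 (E2 (P * Q)) + X * E2 (E2 (Q ^+ 2)).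
  by rewrite {1}Q_bisect !(rmorphM, rmorphXn) /=; ring.
by rewrite Q2E !(rmorphD, rmorphM, rmorph_nat, rmorph0) /=; ring.
Qed.

Lemma orbit_7mod8 f : orbit_form f -> cong 16 (sec 2 1 (sec 2 1 (sec 2 1 f))) 0.
Proof.
case=> al [be fE]; apply: cong_trans (cong_sec 2 1 (cong_sec 2 1 (cong_sec 2 1 fE))) _.
(* The odd exponents of [v] are all 1 mod 4, so a second odd section kills it. *)
set v := _ + X ^+ 2 * _; have vE : sec 2 1 v = E2 be.
  rewrite -[RHS](sec21_bisect (E2 al + X * E2 (E2 Q))); congr (sec 2 1 _).
  by rewrite rmorphD rmorphM /= E2X /v; ring.
clearbody v; rewrite !(secD, secMn) vE sec21E.
have [h ->] := F_7mod8; exists (7 * h).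
by rewrite -[X in sec 2 1 X](rmorph0 E2) sec21E; ring.
Qed.

Lemma iter_U_7mod8 a : cong 16 (sec 2 1 (sec 2 1 (sec 2 1 (iter a U T)))) 0.
Proof.
case: a => [|a]; first exact: T_7mod8 wK.
by apply: orbit_7mod8; elim: a => [|a IHa]; [exact: orbit_form_UT | exact: orbit_form_U].
Qed.
End WithInverse.

Theorem theorem4p3 (alpha n : nat) :
  (schurS (2 ^ (5 + 2 * alpha) * n
      + (2 ^ (5 + 2 * alpha) - (2 ^ (2 + 2 * alpha) - 1) %/ 3))%N
   = 0 %[mod 16])%Z.
Proof.
have [w wK] := phi3'_inv; have [h] := iter_U_7mod8 wK alpha.
move/(congr1 (fun f : ser => f n)); rewrite add0r ser_natmulE -(sec43_S wK).
rewrite !secE iter_UE !secE /=; set k := iter _ _ _ => hE.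
have -> : (2 ^ (5 + 2 * alpha) * n
    + (2 ^ (5 + 2 * alpha) - (2 ^ (2 + 2 * alpha) - 1) %/ 3)
    = 2 * (2 * k + 1) + 1)%N; last by rewrite hE modzMr mod0z.
(* Starting from 8n + 7, this gives 3k + 2 = 4^alpha (24n + 23), from which 4k + 3 is the stated
   index; [dvd3_exp4_pred] makes the division by 3 exact. *)
have := iter_index alpha (2 * (2 * (2 * n + 1) + 1) + 1); rewrite -/k.
have expE m : (2 ^ (m + 2 * alpha) = 2 ^ m * 4 ^ alpha)%N by rewrite expnD expnM.
have := dvd3_exp4_pred alpha; rewrite !expE.
rewrite -[(2 ^ 2)%N]/4%N -[(2 ^ 5)%N]/32%N.
have : (0 < 4 ^ alpha)%N by rewrite expn_gt0.
by move: (4 ^ alpha)%N => x; lia.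
Qed.
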